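(* Let $G$ be a weakly closed graph and let $v$ be a vertex of $G$. Then the graphs $G\setminus v$, $G_v$, and $G_v\setminus v$ are weakly closed.
   Context: Graphs are finite and simple. A graph $G$ on $n$ vertices is weakly closed if there is a labeling of its vertices by $1,\dots,n$ such that for every edge $\{i,j\}$ with $i<j$ and every integer $k$ with $i<k<j$, either $\{i,k\}\in E(G)$ or $\{k,j\}\in E(G)$. For a vertex $v$ of $G$, $N_G(v)=\{u\in V(G)\mid\{u,v\}\in E(G)\}$. The deletion $G\setminus v$ has vertex set $V(G)\setminus\{v\}$ and edge set $E(G)\setminus\{\{u,v\}\mid u\in N_G(v)\}$. The completion $G_v$ of $G$ at $v$ has vertex set $V(G)$ and edge set $E(G)\cup\{\{a,b\}\mid a,b\in N_G(v),\ a\neq b,\ \{a,b\}\notin E(G)\}$. The graph $G_v\setminus v$ is the deletion of $G_v$ at $v$. *)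

(* Defs.v *)
From mathcomp Require Import all_boot.
Set Implicit Arguments.
Unset Strict Implicit.
Unset Printing Implicit Defensive.

Record sgraph (T : finType) := SGraph {
  edge : rel T;
  edge_sym : symmetric edge;
  edge_irrefl : irreflexive edge
}.

(* Labels range over 0, ..., n-1 instead of 1, ..., n; [l i] is the vertex
   carrying the label [i]. *)
Definition weakly_closed_labeling (T : finType) (G : sgraph T)
    (l : 'I_#|T| -> T) : Prop :=
  bijective l /\
  forall i j : 'I_#|T|, i < j -> edge G (l i) (l j) ->
  forall k : 'I_#|T|, i < k < j ->
    edge G (l i) (l k) \/ edge G (l k) (l j).

Definition weakly_closed (T : finType) (G : sgraph T) : Prop :=
  exists l : 'I_#|T| -> T, weakly_closed_labeling G l.

Definition neighbors (T : finType) (G : sgraph T) (v : T) : {set T} :=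
  [set u | edge G u v].

Section GraphOperations.
Variables (T : finType) (G : sgraph T) (v : T).

(* The edges incident to [v] disappear because [v] is not in the vertex type. *)
Definition deletion_edge : rel {u : T | u != v} :=
  fun a b => edge G (val a) (val b).

Lemma deletion_edge_sym : symmetric deletion_edge.
Proof. by move=> a b; rewrite /deletion_edge edge_sym. Qed.

Lemma deletion_edge_irrefl : irreflexive deletion_edge.
Proof. by move=> a; rewrite /deletion_edge edge_irrefl. Qed.

Definition deletion : sgraph {u : T | u != v} :=
  SGraph deletion_edge_sym deletion_edge_irrefl.

Definition completion_edge : rel T :=
  fun a b => edge G a b ||
     [&& a \in neighbors G v, b \in neighbors G v & a != b].

Lemma completion_edge_sym : symmetric completion_edge.
Proof. by move=> a b; rewrite /completion_edge edge_sym eq_sym andbCA. Qed.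

Lemma completion_edge_irrefl : irreflexive completion_edge.
Proof. by move=> a; rewrite /completion_edge edge_irrefl eqxx !andbF. Qed.

Definition completion : sgraph T :=
  SGraph completion_edge_sym completion_edge_irrefl.

End GraphOperations.

(* Main.v *)
Require Import Defs.
From mathcomp Require Import all_boot.

(** A labeling by [0, ..., n-1] matters only through the linear order that it
    induces on the vertices, so weak closedness amounts to the existence of an
    injective rank function with values in [nat] ([weakly_closedP]).  In this
    form the property restricts to induced subgraphs, hence to vertex
    deletions, without any relabeling.

    The completion at [v] keeps the ranking of [G].  Let [a < b < c] with [a]
    and [c] distinct neighbors of [v].  If [b = v], then [b] is adjacent to
    [a].  Otherwise [b] lies strictly between [v] and one of [a], [c]: between
    [v] and [c] if [v < b], between [a] and [v] if [b < v].  Weak closedness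
    of [G], applied to the edge from [v] to that vertex [x], makes [b] adjacent
    to [x] or to [v]; in the second case [b] is itself a neighbor of [v], and
    the completion joins it to both [a] and [c].  The third graph is a deletion
    of a completion. *)

(** Values in [nat] instead of ['I_#|T|] let a ranking be restricted to a
    subtype, where the ranks acquire gaps. *)
Definition weakly_closed_ranking {T : finType} (G : sgraph T) (f : T -> nat) :=
  injective f /\
  forall a b c, f a < f b < f c -> edge G a c -> edge G a b || edge G b c.

(** From a labeling one ranks by its inverse; from a ranking one labels the
    vertices in increasing order of rank. *)
Lemma weakly_closedP {T : finType} (G : sgraph T) :
  weakly_closed G <-> exists f, weakly_closed_ranking G f.
Proof.
split=> [[l [[g lK gK] wcl]]|[f [f_inj wcf]]].
  exists (fun x => val (g x)); split.
    by move=> x y /val_inj; apply: (can_inj gK).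
  move=> a b c /[dup] /andP[ltab ltbc] ltabc eac.
  have := wcl _ _ (ltn_trans ltab ltbc).
  rewrite !gK => /(_ eac _ ltabc); rewrite gK.
  by case=> ->; rewrite ?orbT.
pose r := relpre f leq.
pose s := sort_tuple r (enum_tuple T).
have s_sorted : sorted r s.
  by apply: sort_sorted => x y; apply: leq_total.
have s_inj : injective (tnth s).
  by apply/tuple_uniqP; rewrite sort_uniq enum_uniq.
have s_mono (i j : 'I_#|T|) : i < j -> f (tnth s i) < f (tnth s j).
  move=> ltij; rewrite ltn_neqAle (inj_eq f_inj) (inj_eq s_inj).
  rewrite -(inj_eq val_inj) (ltn_eqF ltij) /=.
  have r_trans : transitive r by move=> y x z; apply: leq_trans.
  have := sorted_ltn_nth r_trans (tnth s i) s_sorted.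
  rewrite [in f _](tnth_nth (tnth s i)) [in X in _ <= f X](tnth_nth (tnth s i)).
  by apply=> //; rewrite inE size_tuple.
exists (tnth s); split; first by apply: inj_card_bij; rewrite // card_ord.
move=> i j _ eij k /andP[ltik ltkj]; apply/orP.
by apply: wcf eij; rewrite !s_mono.
Qed.

Lemma weakly_closed_deletion {T : finType} (G : sgraph T) (v : T) :
  weakly_closed G -> weakly_closed (deletion G v).
Proof.
move=> /weakly_closedP[f [f_inj wcf]]; apply/weakly_closedP.
exists (f \o val); split; first exact: inj_comp f_inj val_inj.
by move=> a b c; apply: wcf.
Qed.

(** The ranking need not change: a vertex strictly between [v] and a neighbor
    [x] of [v] is either already adjacent to [x] or a neighbor of [v], and then
    part of the clique that the completion creates. *)
Lemma weakly_closed_completion {T : finType} (G : sgraph T) (v : T) :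
  weakly_closed G -> weakly_closed (completion G v).
Proof.
move=> /weakly_closedP[f [f_inj wcf]]; apply/weakly_closedP.
exists f; split=> // a b c ltabc; have [ltab ltbc] := andP ltabc.
have neq_ab : a != b by apply: contraTneq ltab => ->; rewrite ltnn.
have neq_bc : b != c by apply: contraTneq ltbc => ->; rewrite ltnn.
rewrite /= /completion_edge !inE neq_ab neq_bc.
case/orP=> [eac|/and3P[eav ecv _]].
  by case/orP: (wcf _ _ _ ltabc eac) => ->; rewrite ?orbT.
rewrite eav ecv /= !andbT.
have [ltbv|ltvb|/f_inj eq_bv] := ltngtP (f b) (f v).
- have /orP[->//|->] : edge G a b || edge G b v.
    by apply: wcf eav; rewrite ltab.
  by rewrite orbT.
- have /orP[|->] : edge G v b || edge G b c.
  + by apply: wcf; rewrite ?ltvb // edge_sym.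
  + by rewrite edge_sym => ->; rewrite orbT.
  + by rewrite !orbT.
- by rewrite eq_bv eav.
Qed.

Theorem proposition10p7 (T : finType) (G : sgraph T) (v : T)
    (hG : weakly_closed G) :
  weakly_closed (deletion G v) /\
  weakly_closed (completion G v) /\
  weakly_closed (deletion (completion G v) v).
Proof.
have hGv := weakly_closed_completion G v hG.
split; first exact: weakly_closed_deletion.
by split; last exact: weakly_closed_deletion.
Qed.
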